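(* There exist a family $(\Delta_d)_{d\ge 2}$, where for each integer $d\ge 2$ the set $\Delta_d\subseteq\mathbb{R}^d$ is a $d$-dimensional lattice-free simplex, such that $\operatorname{lw}(\Delta_d)=2d-O(\sqrt d)$; that is, there is a constant $C>0$ and a function $f:\{2,3,\dots\}\to\mathbb{R}$ with $|f(d)|\le C\sqrt d$ and $\operatorname{lw}(\Delta_d)=2d-f(d)$ for all $d\ge 2$.
   Context: A convex body in $\mathbb{R}^d$ is called lattice-free if it does not contain any point of $\mathbb{Z}^d$ in its interior. The lattice width of a convex body $K\subseteq\mathbb{R}^d$ is $$\operatorname{lw}(K):=\min\Big\{\max_{x\in K}\langle x,y\rangle-\min_{x\in K}\langle x,y\rangle : y\in\mathbb{Z}^d\setminus\{\mathbf{0}\}\Big\},$$ where $\langle\cdot,\cdot\rangle$ is the standard scalar product. *)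

(* Defs.v *)
From HB Require Import structures.
From mathcomp Require Import all_boot all_order all_algebra.
From mathcomp Require Import all_classical all_reals all_analysis.

Set Implicit Arguments.
Unset Strict Implicit.
Unset Printing Implicit Defensive.

Import Order.TTheory GRing.Theory Num.Theory.
Import numFieldNormedType.Exports.

Local Open Scope classical_set_scope.
Local Open Scope ring_scope.

Definition int_vec (R : realType) (d : nat) (z : 'rV[int]_d) : 'rV[R]_d :=
  map_mx intr z.

Definition inner (R : realType) (d : nat) (x y : 'rV[R]_d) : R :=
  \sum_(i < d) x ord0 i * y ord0 i.

(* The topology on ['rV[R]_d] is the product one, i.e., the usual topology
   of R^d, so [K°] is the usual interior. *)
Definition lattice_free (R : realType) (d : nat) (K : set 'rV[R]_d) : Prop :=
  forall z : 'rV[int]_d, ~ K° (int_vec R z).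

Definition affinely_independent (R : realType) (d k : nat)
    (v : 'I_k.+1 -> 'rV[R]_d) : Prop :=
  row_free (\matrix_(i < k) (v (lift ord0 i) - v ord0)).

Definition convex_hull (R : realType) (d k : nat)
    (v : 'I_k -> 'rV[R]_d) : set 'rV[R]_d :=
  [set x | exists c : 'I_k -> R,
    [/\ forall i, 0 <= c i, \sum_(i < k) c i = 1
      & x = \sum_(i < k) c i *: v i]].

(* [k] is the dimension of the simplex, which has [k.+1] vertices. *)
Definition is_simplex (R : realType) (d k : nat) (K : set 'rV[R]_d) : Prop :=
  exists v : 'I_k.+1 -> 'rV[R]_d,
    affinely_independent v /\ K = convex_hull v.

Definition is_max (R : realType) (A : set R) (m : R) : Prop :=
  A m /\ ubound A m.

Definition is_min (R : realType) (A : set R) (m : R) : Prop :=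
  A m /\ lbound A m.

(* Widths are relations rather than functions valued in [R], so that stating
   that a number is a width asserts that the maxima and minima exist. *)
Definition is_width (R : realType) (d : nat) (K : set 'rV[R]_d)
    (y : 'rV[R]_d) (w : R) : Prop :=
  exists a b : R,
    [/\ is_max [set inner x y | x in K] b,
        is_min [set inner x y | x in K] a
      & w = b - a].

Definition is_lattice_width (R : realType) (d : nat) (K : set 'rV[R]_d)
    (w : R) : Prop :=
  is_min [set u | exists2 y : 'rV[int]_d, y != 0 & is_width K (int_vec R y) u] w.

(* Main.v *)
Require Import Defs.
From HB Require Import structures.
From mathcomp Require Import all_boot all_order all_algebra.
From mathcomp Require Import all_classical all_reals all_analysis.
From mathcomp Require Import ring lra zify.

Set Implicit Arguments.
Unset Strict Implicit.
Unset Printing Implicit Defensive.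

Import Order.TTheory GRing.Theory Num.Theory.
Import numFieldNormedType.Exports.
Local Open Scope classical_set_scope.
Local Open Scope ring_scope.

(** Write [n = d + 1]. Identify [Z^d] with the integer points of the hyperplane
    [x_0 + ... + x_d = 1] of [R^n] by dropping the last coordinate, and let the
    cyclic group of order [n] act by shifting indices. The simplex is the hull
    of the orbit of one point: its vertices are
    [V_k = t (1, ..., 1) - P e_k + r P e_(k-1)], indices modulo [n], with
    [0 < r < 1], where [t] is fixed by [t (1 + r + ... + r^d) = 1] and [P] by
    the requirement that the coordinates of [V_k] sum to 1.

    Lattice-freeness. If [x] has barycentric coordinates [c_k], then
    [x_j = t - P c_j + r P c_(j+1)], so the discounted sum
    [x_k + r x_(k+1) + ... + r^d x_(k+d)] telescopes to
    [1 - P (1 - r^n) c_k]. At an interior point all [c_k] are positive, so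
    every such sum is less than 1. But [n] integers with sum 1 on a cycle have
    a starting point from which all partial sums are at least 1
    ([cyclic_positive_partial_sums]), and then, the weights [r^i] being
    decreasing, the discounted sum from there is at least 1 too
    ([discounted_sum_lower_bound]): no integer point is interior.

    Width. An integer functional [y] on [R^d] becomes the closed walk
    [Z = (0, y_0, ..., y_(d-1), 0)], and its values at the vertices are, up to
    a common constant, [- P (Z_(k+1) - r Z_k)]. A nonzero closed integer walk
    crosses some level upwards and downwards; comparing these two steps shows
    that the values [Z_(k+1) - r Z_k] spread over at least [1 + r]
    ([closed_walk_spread]), with equality for [y = e_0]. Hence the lattice width
    is exactly [P (1 + r)] ([cyclic_simplex_lattice_width]).

    Here [P = n / (1 - r^n) - 1 / (1 - r)]. Taking [r] close to 1 brings the
    factor [1 + r] close to 2 but makes the loss [1 / (1 - r)] large; the choice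
    [1 - r = 1 / sqrt n] balances the two losses and gives
    [P (1 + r) = 2 d - O(sqrt d)] ([cyclic_parameters]). *)

(** * Integer sequences on a cycle *)

(** Raney's cycle lemma. Let [X] be the sequence of partial sums of [x]. It
    grows by 1 over each period, so [n X_m - m] is periodic and attains its
    minimum, at [k] say. For [j > 0], minimality gives
    [n (X_(k+j) - X_k) >= j > 0], and integrality turns this into
    [X_(k+j) - X_k >= 1]. *)
Lemma cyclic_positive_partial_sums (n : nat) (x : nat -> int) :
  (forall i, x (i + n)%N = x i) -> \sum_(i < n) x i = 1 ->
  exists k, forall j, (0 < j)%N -> 1 <= \sum_(i < j) x (k + i)%N.
Proof.
move=> xper xsum.
case: n => [|n] in xper xsum *; first by rewrite big_ord0 in xsum.
pose X m := \sum_(i < m) x i.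
have XD m j : X (m + j)%N = X m + \sum_(i < j) x (m + i)%N.
  by rewrite /X big_split_ord.
have Xper m : X (m + n.+1)%N = X m + 1.
  rewrite addnC XD {1}/X xsum addrC; congr (_ + _).
  by apply: eq_bigr => i _; rewrite addnC xper.
pose G j : int := n.+1%:Z * X j - j%:Z.
have Gper j : G (j + n.+1)%N = G j by rewrite /G Xper PoszD; ring.
have Gmod j : G j = G (j %% n.+1)%N.
  rewrite {1}(divn_eq j n.+1); elim: (j %/ n.+1)%N => [|q IH].
    by rewrite mul0n add0n.
  by rewrite -IH -[in RHS]Gper mulSn; congr G; lia.
pose k := [arg min_(i < ord0 : 'I_n.+1) G i]%O.
have kmin j : G k <= G j.
  rewrite (Gmod j); have jn : (j %% n.+1 < n.+1)%N by rewrite ltn_mod.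
  by rewrite /k; case: arg_minP => // i _ /(_ (Ordinal jn) isT).
exists k => j j0; have := kmin (k + j)%N.
rewrite /G XD; set S := \sum_(i < j) _ => h.
have jZ : 0 < j%:Z by lia.
have h1 : 0 < n.+1%:Z * S by move: h; rewrite mulrDr PoszD; lra.
have : 0 < S by rewrite -(pmulr_rgt0 S (_ : 0 < n.+1%:Z)).
by lia.
Qed.

(** This is Abel summation in inductive form. The extra term
    [r ^+ m * (S - 1)], with [S] the plain partial sum, is what makes the
    induction go through: since [S >= 1], lowering the weight of [S - 1] from
    [r ^+ m] to [r ^+ m.+1] only decreases it. *)
Lemma discounted_sum_lower_bound (R : realDomainType) (r : R) (x : nat -> R)
    (m : nat) :
  0 <= r <= 1 ->
  (forall j, (0 < j)%N -> 1 <= \sum_(i < j) x i) ->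
  1 + r ^+ m * (\sum_(i < m.+1) x i - 1) <= \sum_(i < m.+1) r ^+ i * x i.
Proof.
move=> /andP[r0 r1] hx; elim: m => [|m IH].
  by rewrite !big_ord_recl !big_ord0 expr0; lra.
rewrite [in leRHS]big_ord_recr [in leLHS]big_ord_recr/=.
have := hx m.+1 isT; set S := \sum_(i < m.+1) x i => S1.
apply: le_trans (_ : _ <= 1 + r ^+ m * (S - 1) + r ^+ m.+1 * x m.+1) _;
  last by rewrite lerD2r.
have : r ^+ m.+1 * (S - 1) <= r ^+ m * (S - 1).
  by apply: ler_wpM2r; [rewrite subr_ge0 | rewrite exprS ler_piMl// exprn_ge0].
rewrite !mulrBr !mulrDr; lra.
Qed.

(** * Convex hulls *)

(** The segment from the barycentre [p] to an interior point [z] can be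
    prolonged inside the hull to [z + e (z - p)]; then [z] is a proper convex
    combination of this point and [p], and [p] contributes a positive weight to
    every vertex. *)
Lemma interior_hull_positive (R : realType) (d k : nat)
    (v : 'I_k.+1 -> 'rV[R]_d) (z : 'rV[R]_d) :
  (convex_hull v)° z ->
  exists c : 'I_k.+1 -> R,
    [/\ forall i, 0 < c i, \sum_i c i = 1 & z = \sum_i c i *: v i].
Proof.
move=> zint.
pose p : 'rV[R]_d := \sum_i (k.+1%:R)^-1 *: v i.
have [e e0 [c [c0 c1 zc]]] :
    exists2 e : R, 0 < e & convex_hull v (z + e *: (z - p)).
  have cvz : (fun e : R => z + e *: (z - p)) @ (0 : R)^'+ --> z.
    have h0 : (fun e : R => z + e *: (z - p)) @ (0 : R) --> z + 0 *: (z - p).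
      by apply: cvgD; [exact: cvg_cst | apply: cvgZr_tmp; exact: cvg_id].
    by have := cvg_at_right_filter h0; rewrite scale0r addr0.
  have [e /andP[]] : exists e : R, (0 < e) && `[< convex_hull v (z + e *: (z - p)) >].
    near (0:R)^'+ => e; exists e; apply/andP; split => //.
    apply/asboolP; near: e; exact: cvz zint.
  by move=> e0 /asboolP he; exists e.
have e1 : 0 < 1 + e by lra.
have kR : 0 < (k.+1%:R : R) by rewrite ltr0n.
exists (fun i => (1 + e)^-1 * (c i + e / k.+1%:R)); split.
- by move=> i; rewrite mulr_gt0 ?invr_gt0// ltr_wpDl ?divr_gt0.
- rewrite -mulr_sumr big_split/= c1 sumr_const card_ord -[_ *+ _]mulr_natr.
  by rewrite divfK ?gt_eqF// mulVf ?gt_eqF.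
- have -> : z = (1 + e)^-1 *: ((z + e *: (z - p)) + e *: p).
    rewrite scalerBr addrA subrK -{2}[z]scale1r -scalerDl scalerA.
    by rewrite mulVf ?gt_eqF// scale1r.
  rewrite zc /p scaler_sumr -big_split/= scaler_sumr.
  by apply: eq_bigr => i _; rewrite scalerA -scalerDl scalerA.
Unshelve. all: by end_near.
Qed.

Lemma vertex_in_hull (R : realType) (d k : nat) (v : 'I_k.+1 -> 'rV[R]_d) i :
  convex_hull v (v i).
Proof.
exists (fun j => (j == i)%:R); split.
- by move=> j; rewrite ler0n.
- by rewrite (bigD1 i)//= eqxx big1 ?addr0// => j /negPf->.
- rewrite (bigD1 i)//= eqxx scale1r big1 ?addr0// => j /negPf->.
  by rewrite scale0r.
Qed.

Lemma inner_comb (R : realType) (d k : nat) (v : 'I_k -> 'rV[R]_d)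
    (c : 'I_k -> R) (y : 'rV[R]_d) :
  inner (\sum_i c i *: v i) y = \sum_i c i * inner (v i) y.
Proof.
rewrite /inner; under eq_bigr => j _ do rewrite summxE mulr_suml.
rewrite exchange_big/=; apply: eq_bigr => i _; rewrite mulr_sumr.
by apply: eq_bigr => j _; rewrite mxE mulrA.
Qed.

Lemma hull_width (R : realType) (d n : nat) (v : 'I_n.+1 -> 'rV[R]_d)
    (y : 'rV[R]_d) (k l : 'I_n.+1) :
  (forall i, inner (v l) y <= inner (v i) y <= inner (v k) y) ->
  is_width (convex_hull v) y (inner (v k) y - inner (v l) y).
Proof.
move=> h; exists (inner (v l) y), (inner (v k) y); split=> //; split.
- by exists (v k) => //; exact: vertex_in_hull.
- move=> _ [_ [c [c0 c1 ->]] <-]; rewrite inner_comb -[leRHS]mul1r -c1 mulr_suml.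
  by apply: ler_sum => i _; apply: ler_wpM2l => //; case/andP: (h i).
- by exists (v l) => //; exact: vertex_in_hull.
- move=> _ [_ [c [c0 c1 ->]] <-]; rewrite inner_comb -[leLHS]mul1r -c1 mulr_suml.
  by apply: ler_sum => i _; apply: ler_wpM2l => //; case/andP: (h i).
Qed.

(** * The simplex *)

(** The vertex [V_k], with its last coordinate (number [d]) dropped. No
    reduction modulo [d + 1] occurs because [j < d]; for [k = 0] the entry [r P]
    falls on the dropped coordinate. *)
Definition cyclic_vertex (R : realType) (d : nat) (r t P : R)
    (k : 'I_d.+1) : 'rV[R]_d :=
  \row_j (t - P * (j == k :> nat)%:R + r * P * (j.+1 == k)%:R).
Arguments cyclic_vertex {R} d r t P k.

Lemma cyclic_vertex_comb (R : realType) (d : nat) (r t P : R)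
    (c : 'I_d.+1 -> R) (j : 'I_d) :
  (\sum_k c k *: cyclic_vertex d r t P k) ord0 j
  = t * (\sum_k c k) - P * c (inord j) + r * P * c (inord j.+1).
Proof.
have pick (b : nat) : (b < d.+1)%N ->
    \sum_(k < d.+1) c k * (b == k)%:R = c (inord b).
  move=> bd; rewrite (bigD1 (inord b))//= inordK// eqxx mulr1 big1 ?addr0//.
  move=> k /negP kb; case: eqP => [bk|]; last by rewrite mulr0.
  by case: kb; rewrite bk inord_val.
rewrite summxE -(pick j) ?ltnS 1?ltnW// -(pick j.+1) ?ltnS//.
rewrite !mulr_sumr -sumrB -big_split/=; apply: eq_bigr => k _.
by rewrite !mxE; ring.
Qed.

(** A dependency [c] between the vertices, with sum 0, satisfies
    [c_j = r c_(j+1)] by reading off coordinate [j], so all its entries are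
    positive multiples of the last one and the sum can vanish only if they
    do. *)
Lemma cyclic_vertex_free (R : realType) (d : nat) (r t P : R) :
  0 < r -> 0 < P -> affinely_independent (cyclic_vertex d r t P).
Proof.
move=> r0 P0; apply: inj_row_free => u uM.
pose c (k : 'I_d.+1) : R :=
  oapp (u ord0) (- \sum_i u ord0 i) (unlift ord0 k).
have c0 : c ord0 = - \sum_i u ord0 i by rewrite /c unlift_none.
have cl i : c (lift ord0 i) = u ord0 i by rewrite /c liftK.
have cS : \sum_k c k = 0.
  by rewrite big_ord_recl c0 (eq_bigr _ (fun i _ => cl i)) addNr.
have cv : \sum_k c k *: cyclic_vertex d r t P k = 0.
  rewrite big_ord_recl c0 -[RHS]uM mulmx_sum_row scaleNr scaler_suml addrC.
  by rewrite -sumrB; apply: eq_bigr => i _; rewrite cl rowK scalerBr.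
have crec j : (j < d)%N -> c (inord j) = r * c (inord j.+1).
  move=> jd; have := cyclic_vertex_comb r t P c (Ordinal jd).
  rewrite cv cS mxE mulr0 add0r/= => h.
  by apply: (mulfI (lt0r_neq0 P0)); lra.
have cpow j : (j <= d)%N -> c (inord (d - j)) = r ^+ j * c (inord d).
  elim: j => [|j IH] jd; first by rewrite subn0 mul1r.
  rewrite crec; last by lia.
  by rewrite -subSn// subSS IH ?(ltnW jd)// exprS mulrA.
have cd0 : c (inord d) = 0.
  move: cS; rewrite (eq_bigr (fun k : 'I_d.+1 => r ^+ (d - k) * c (inord d))).
    rewrite -mulr_suml => /eqP; rewrite mulf_eq0 => /orP[/eqP S0|/eqP//].
    have : 0 < \sum_(k < d.+1) r ^+ (d - k).
      by rewrite big_ord_recl/= ltr_pwDl ?exprn_gt0// sumr_ge0// => k _;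
        rewrite exprn_ge0// ltW.
    by rewrite S0 ltxx.
  by move=> k _; rewrite -cpow ?leq_subr// subKn ?inord_val// -ltnS.
apply/rowP => i; rewrite mxE -cl.
have : (lift ord0 i <= d)%N by rewrite -ltnS.
move=> /subKn; move: (lift ord0 i) => k kd.
by rewrite -[k]inord_val -kd cpow ?leq_subr// cd0 mulr0.
Qed.

(** * Lattice-freeness *)

(** The two normalizations play different parts: the one on [t] makes every
    discounted sum equal to [1 - P (1 - r^n) c_k], with constant term exactly 1,
    and the one on [P] makes the coordinate sum of each [V_k] equal to 1, as the
    cycle lemma requires of [x]. *)
Lemma cyclic_simplex_lattice_free (R : realType) (d : nat) (r t P : R) :
  0 < r < 1 -> 0 < P ->
  t * (\sum_(i < d.+1) r ^+ i) = 1 -> d.+1%:R * t - P + r * P = 1 ->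
  lattice_free (convex_hull (cyclic_vertex d r t P)).
Proof.
move=> /andP[r0 r1] P0 tr tP z /interior_hull_positive[c [c0 c1 zc]].
have zE (j : 'I_d) : (z ord0 j)%:~R
    = t - P * c (inord j) + r * P * c (inord j.+1).
  by move/rowP/(_ j): zc; rewrite cyclic_vertex_comb c1 mulr1 mxE.
(* The point of the hyperplane over [z], and its barycentric coordinates, as
   sequences of period [d + 1]. *)
pose x (i : nat) : int :=
  oapp (z ord0) (1 - \sum_j z ord0 j) (insub (i %% d.+1)%N).
pose C (i : nat) : R := c (inord (i %% d.+1)%N).
have xsmall (j : 'I_d) : x j = z ord0 j.
  rewrite /x modn_small; last exact: ltnW (ltn_ord j).
  by rewrite valK.
have xlast : x d = 1 - \sum_j z ord0 j.
  by rewrite /x modn_small// insubN// ltnn.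
have xper i : x (i + d.+1)%N = x i by rewrite /x modnDr.
have xsum : \sum_(i < d.+1) x i = 1.
  rewrite big_ord_recr/= xlast; under eq_bigr => i _ do rewrite xsmall.
  by rewrite addrC subrK.
(* The dropped coordinate obeys the same law because the coordinates of each
   [V_k] sum to 1; this is what [tP] expresses. *)
have xlastE : (x d)%:~R = t - P * c (inord d) + r * P * c (inord 0).
  have e1 : \sum_(j < d) c (inord j) = 1 - c (inord d).
    rewrite -c1 big_ord_recr/= (_ : ord_max = inord d); last first.
      by apply/val_inj; rewrite /= inordK.
    rewrite addrK; apply: eq_bigr => j _; congr c.
    by apply/val_inj; rewrite /= inordK// ltnW// ltnS.
  have e2 : \sum_(j < d) c (inord j.+1) = 1 - c (inord 0).
    have -> : inord 0 = ord0 :> 'I_d.+1 by apply/val_inj; rewrite /= inordK.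
    rewrite -c1 big_ord_recl/= addrAC subrr add0r.
    by apply: eq_bigr => j _; congr c; apply/val_inj; rewrite /= inordK// ltnS.
  rewrite xlast rmorphB rmorph_sum/=; under eq_bigr => j _ do rewrite zE.
  rewrite big_split sumrB/= -!mulr_sumr e1 e2 sumr_const card_ord -mulr_natl.
  by move: tP; rewrite -natr1 mulrDl mul1r; lra.
have xE i : (x i)%:~R = t - P * C i + r * P * C i.+1.
  have -> : x i = x (i %% d.+1)%N by rewrite /x modn_mod.
  have idn : (i %% d.+1 < d.+1)%N by rewrite ltn_mod.
  have : (i.+1 %% d.+1)%N = ((i %% d.+1).+1 %% d.+1)%N.
    by rewrite -addn1 -[in RHS]addn1 modnDml.
  rewrite /C => ->; move: (i %% d.+1)%N idn => m.
  rewrite ltnS leq_eqVlt => /orP[/eqP ->|md].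
    by rewrite modnn xlastE.
  by rewrite (xsmall (Ordinal md)) zE [(m.+1 %% _)%N]modn_small.
have Cper i : C (i + d.+1)%N = C i by rewrite /C modnDr.
have [k kpos] := cyclic_positive_partial_sums xper xsum.
have telescope m : \sum_(i < m) r ^+ i * (x (k + i)%N)%:~R
    = t * (\sum_(i < m) r ^+ i) - P * (C k - r ^+ m * C (k + m)%N).
  elim: m => [|m IH].
    by rewrite !big_ord0 addn0 expr0; ring.
  by rewrite !big_ord_recr/= IH xE exprS addnS; ring.
have kposR j : (0 < j)%N -> 1 <= \sum_(i < j) (x (k + i)%N)%:~R :> R.
  by move=> /kpos; rewrite -(ler_int R) rmorph_sum.
have r01 : 0 <= r <= 1 by rewrite !ltW.
have := discounted_sum_lower_bound
  (x := fun i => (x (k + i)%N)%:~R) d r01 kposR.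
rewrite telescope tr Cper.
have : 0 <= r ^+ d * (\sum_(i < d.+1) (x (k + i)%N)%:~R - 1).
  by rewrite mulr_ge0 ?exprn_ge0 ?(ltW r0)// subr_ge0 kposR.
have : 0 < P * (C k - r ^+ d.+1 * C k).
  by rewrite -[X in X - _]mul1r -mulrBl !mulr_gt0// ?c0// subr_gt0 exprn_ilt1// ltW.
lra.
Qed.

(** * The lattice width *)

(** The closed walk [0, y_0, ..., y_(d-1), 0, 0, ...]. The final 0 is the
    coefficient of the dropped coordinate, and the initial 0 is the same
    coefficient met again one turn earlier on the cycle. *)
Definition zero_padded (d : nat) (y : 'rV[int]_d) (m : nat) : int :=
  if m is i.+1 then oapp (y ord0) 0 (insub i) else 0.

Lemma inner_cyclic_vertex (R : realType) (d : nat) (r t P : R)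
    (y : 'rV[int]_d) (k : 'I_d.+1) :
  inner (cyclic_vertex d r t P k) (int_vec R y)
  = t * (\sum_j (y ord0 j)%:~R)
    - P * ((zero_padded y k.+1)%:~R - r * (zero_padded y k)%:~R).
Proof.
have pick b : \sum_(j < d) (y ord0 j)%:~R * (j == b :> nat)%:R
    = (zero_padded y b.+1)%:~R :> R.
  rewrite /zero_padded; case: insubP => [j _ jb|bd]/=.
    rewrite (bigD1 j)//= jb eqxx mulr1 big1 ?addr0// => i ij.
    by rewrite -jb -val_eqE/= in ij *; rewrite (negPf ij) mulr0.
  rewrite big1// => j _; case: eqP => [jb|]; last by rewrite mulr0.
  by rewrite -jb ltn_ord in bd.
have pick' : \sum_(j < d) (y ord0 j)%:~R * (j.+1 == k)%:R
    = (zero_padded y k)%:~R :> R.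
  case: k => [[|k] kd]/=; last by rewrite -pick.
  by rewrite big1// => j _; rewrite mulr0.
rewrite -pick -pick' mulrBr opprB addrC /inner !mulr_sumr -sumrB -big_split/=.
by apply: eq_bigr => j _; rewrite !mxE; ring.
Qed.

Lemma exists_crossing (p : pred nat) (a b : nat) :
  (a <= b)%N -> ~~ p a -> p b ->
  exists k, [/\ (a <= k < b)%N, ~~ p k & p k.+1].
Proof.
elim: b => [|b IH]; first by rewrite leqn0 => /eqP-> /negPf->.
rewrite leq_eqVlt => /orP[/eqP-> /negPf->//|]; rewrite ltnS => ab pa pb.
have [pb'|pb'] := boolP (p b); last by exists b; rewrite ab leqnn.
have [k [/andP[ak kb] pk pk1]] := IH ab pa pb'.
by exists k; rewrite ak (ltn_trans kb).
Qed.

(** Both crossings concern the same level: [Z] goes from at most [M - 1] to at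
    least [M] at step [k], and back at step [l]. The step at [k] contributes at
    least [M - r (M - 1)] and the one at [l] at most [(M - 1) - r M]; the
    difference of these bounds is [1 + r], whatever [M]. *)
Lemma closed_walk_spread (R : realDomainType) (r : R) (Z : nat -> int) (n j : nat) :
  0 <= r -> (j <= n)%N -> Z 0%N = 0 -> Z n = 0 -> Z j != 0 ->
  exists k l, [/\ (k < n)%N, (l < n)%N &
    1 + r <= ((Z k.+1)%:~R - r * (Z k)%:~R) - ((Z l.+1)%:~R - r * (Z l)%:~R)].
Proof.
move=> r0 jn Z0 Zn Zj.
(* Level 1 if the walk becomes positive, level 0 if it becomes negative. *)
suff [M [k [l [kn ln [k1 k2 l1 l2]]]]] : exists (M : int) k l,
    [/\ (k < n)%N, (l < n)%N &
      [/\ Z k <= M - 1, M <= Z k.+1, M <= Z l & Z l.+1 <= M - 1]].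
  exists k, l; split=> //.
  move: k1 k2 l1 l2; rewrite -!(ler_int R) rmorphB/= => k1 k2 l1 l2.
  have := ler_wpM2l r0 k1; have := ler_wpM2l r0 l1.
  by rewrite mulrBr mulr1; lra.
have [Zpos|Zneg] : 0 < Z j \/ Z j < 0 by lia.
- have [k [kj k1 k2]] := @exists_crossing (fun i => 1 <= Z i) 0 j
    (leq0n _) ltac:(lia) ltac:(lia).
  have [l [jl l1 l2]] := @exists_crossing (fun i => Z i < 1) j n
    jn ltac:(lia) ltac:(lia).
  by exists 1, k, l; do ?split; lia.
- have [l [lj l1 l2]] := @exists_crossing (fun i => Z i < 0) 0 j
    (leq0n _) ltac:(lia) ltac:(lia).
  have [k [jk k1 k2]] := @exists_crossing (fun i => 0 <= Z i) j n
    jn ltac:(lia) ltac:(lia).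
  by exists 0, k, l; do ?split; lia.
Qed.

(** The functional [e_0] has walk [0, 1, 0, ..., 0], which takes the values
    [1], [- r] and [0] for [Z_(k+1) - r Z_k] and so meets the bound of
    [closed_walk_spread] exactly. *)
Lemma cyclic_simplex_lattice_width (R : realType) (d : nat) (r t P : R) :
  0 <= r -> 0 < P ->
  is_lattice_width (convex_hull (cyclic_vertex d.+1 r t P)) (P * (1 + r)).
Proof.
move=> r0 P0; split.
- pose y : 'rV[int]_d.+1 := delta_mx ord0 ord0.
  have Zy m : (m <= d.+2)%N -> zero_padded y m = (m == 1)%N%:Z.
    case: m => [|m] md //=; case: insubP => [j _ jm|].
      by rewrite /= mxE eqxx/= -jm eqSS natz.
    by case: m md.
  exists y.
    by apply/eqP => /rowP/(_ ord0)/eqP; rewrite !mxE.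
  have vy (k : 'I_d.+2) := inner_cyclic_vertex r t P y k.
  have -> : P * (1 + r) =
      inner (cyclic_vertex d.+1 r t P (inord 1)) (int_vec R y)
      - inner (cyclic_vertex d.+1 r t P ord0) (int_vec R y).
    by rewrite !vy inordK// !Zy//=; ring.
  apply: hull_width => i; rewrite !vy inordK// !Zy ?(ltnW (ltn_ord i))//=.
  have Pr : 0 <= P * r by rewrite mulr_ge0// ltW.
  by case: i => [[|[|i]] id]/=; rewrite ?eqSS/=; apply/andP; split; lra.
- move=> u [y y0 [a [b [[_ hb] [_ ha] ->]]]].
  have [j Zj] : exists j : 'I_d.+1, y ord0 j != 0.
    apply/existsP; apply: contra_neqT y0 => /existsPn h.
    by apply/rowP => j; rewrite mxE; apply/eqP/negbNE/h.
  have Zend : zero_padded y d.+2 = 0.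
    by rewrite /=; case: insubP => //= -[i /= id] _ ie; lia.
  have Zj' : zero_padded y j.+1 != 0.
    rewrite /= insubT//= => jd.
    by rewrite (_ : Sub _ _ = j)//; exact: val_inj.
  have jn : (j.+1 <= d.+2)%N by rewrite ltnW// ltnS.
  have [k [l [kd ld kl]]] := closed_walk_spread r0 jn erefl Zend Zj'.
  have hk := ha _ (imageP (fun x => inner x (int_vec R y))
    (vertex_in_hull (cyclic_vertex d.+1 r t P) (Ordinal kd))).
  have hl := hb _ (imageP (fun x => inner x (int_vec R y))
    (vertex_in_hull (cyclic_vertex d.+1 r t P) (Ordinal ld))).
  apply: le_trans (lerB hl hk).
  rewrite !inner_cyclic_vertex.
  have := ler_wpM2l (ltW P0) kl; rewrite [X in _ <= X -> _]mulrBr.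
  move: (P * (_ - _)) (P * (_ - _)) => A B.
  lra.
Qed.

(** * Choice of the parameters *)

(** Bernoulli's inequality for the inverse power: with [h = 1 / sqrt n] it
    bounds [r ^+ n] by [1 / (1 + sqrt n)], which is enough to make the wrap-around
    correction [n r^n / (1 - r^n)] at most [sqrt n]. *)
Lemma bernoulli_decay (R : realDomainType) (h : R) (n : nat) :
  0 <= h <= 1 -> (1 - h) ^+ n * (1 + n%:R * h) <= 1.
Proof.
move=> /andP[h0 h1]; elim: n => [|n IH]; first by rewrite expr0; lra.
apply: le_trans IH; rewrite exprSr -mulrA ler_wpM2l ?exprn_ge0 ?subr_ge0//.
have : 0 <= n.+1%:R * (h * h) by rewrite !mulr_ge0.
by rewrite -natr1 !mulrDl !mulrDr !mulNr; lra.
Qed.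

(** With [s = sqrt (d + 1)], [r = 1 - 1 / s] and [T = (d + 1) t], solving the
    normalization for [P] gives [P = s (T - 1)], and [P (1 + r)] becomes
    [(T - 1) (2 s - 1)]. Since [T (1 - r^n) = s], the Bernoulli bound places [T]
    between [s] and [s + 1], so the width differs from [2 d = 2 s^2 - 2] by at
    most [3 s], and [s <= 2 sqrt d]. *)
Lemma cyclic_parameters (R : realType) (d : nat) : (0 < d)%N ->
  exists r t P : R,
    [/\ 0 < r < 1, 0 < P, t * (\sum_(i < d.+1) r ^+ i) = 1,
        d.+1%:R * t - P + r * P = 1
      & `|2 * d%:R - P * (1 + r)| <= 6 * Num.sqrt d%:R].
Proof.
move=> d0.
pose s : R := Num.sqrt d.+1%:R.
have s2 : s * s = d.+1%:R by rewrite -expr2 sqr_sqrtr.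
have s1 : 1 < s by rewrite -[ltLHS]sqrtr1 ltr_sqrt// ltr1n.
have s0 : 0 < s by lra.
have h0 : 0 < s^-1 by rewrite invr_gt0.
have h1 : s^-1 < 1 by rewrite invf_lt1.
have hs : s^-1 * s = 1 by rewrite mulVf// gt_eqF.
pose r := 1 - s^-1; pose q := r ^+ d.+1.
pose S := \sum_(i < d.+1) r ^+ i.
have qS : 1 - q = s^-1 * S.
  by have := subrX1 r d.+1; rewrite -/q -/S /r; lra.
have S0 : 0 < S.
  rewrite /S big_ord_recl expr0 ltr_pwDl// sumr_ge0// => i _.
  by rewrite exprn_ge0// subr_ge0 ltW.
have q0 : 0 < q by rewrite exprn_gt0// subr_gt0.
have qs : q * (1 + s) <= 1.
  have := @bernoulli_decay R s^-1 d.+1; rewrite -s2 -mulrA mulfV ?gt_eqF//.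
  by rewrite mulr1; apply; rewrite !ltW.
have q1 : 0 < 1 - q by rewrite qS mulr_gt0.
pose T := d.+1%:R * S^-1.
have T0 : 0 < T by rewrite mulr_gt0 ?invr_gt0.
have TqS : T * (1 - q) = s.
  by rewrite qS /T -s2; field; rewrite !gt_eqF.
have sT : s <= T by rewrite -TqS ler_piMr ?(ltW T0)//; lra.
have Ts : T <= s + 1.
  by rewrite -(ler_pM2r q1) TqS; lra.
exists r, S^-1, (s * (T - 1)); split.
- by rewrite /r; apply/andP; split; lra.
- by rewrite mulr_gt0//; lra.
- by rewrite mulVf// gt_eqF.
- rewrite -/T -[_ - _ + _]addrA -{1}[_ * (T - 1)]mul1r -mulNr -mulrDl /r.
  by rewrite mulrA [- 1 + _]addrA addNr add0r mulNr hs; lra.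
- have dE : d%:R = s * s - 1 :> R by rewrite s2 -natr1 addrK.
  have -> : s * (T - 1) * (1 + r) = (T - 1) * (2 * s - 1).
    by rewrite /r; field; rewrite gt_eqF.
  apply: (@le_trans _ _ (3 * s)).
    rewrite dE ler_norml.
    have a : (s - 1) * (2 * s - 1) <= (T - 1) * (2 * s - 1).
      by apply: ler_wpM2r; lra.
    have b : (T - 1) * (2 * s - 1) <= s * (2 * s - 1).
      by apply: ler_wpM2r; lra.
    by apply/andP; split; nra.
  have -> : 6 * Num.sqrt d%:R = 3 * Num.sqrt (4 * d%:R) :> R.
    by rewrite sqrtrM// (_ : 4 = 2 ^+ 2) ?sqrtr_sqr ?ger0_norm//; ring.
  rewrite ler_wpM2l// ler_wsqrtr// -natrM ler_nat; lia.
Qed.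

Theorem theorem1 (R : realType) :
  exists Delta : forall d : nat, set 'rV[R]_d,
    (forall d : nat, (2 <= d)%N ->
       is_simplex d (Delta d) /\ lattice_free (Delta d)) /\
    exists (C : R) (f : nat -> R),
      0 < C /\
      forall d : nat, (2 <= d)%N ->
        `|f d| <= C * Num.sqrt (d%:R) /\
        is_lattice_width (Delta d) (2 * d%:R - f d).
Proof.
have /choice[g gP] : forall d, exists g : R * R * R, (0 < d)%N ->
    let: (r, t, P) := g in
    [/\ 0 < r < 1, 0 < P, t * (\sum_(i < d.+1) r ^+ i) = 1,
        d.+1%:R * t - P + r * P = 1
      & `|2 * d%:R - P * (1 + r)| <= 6 * Num.sqrt d%:R].
  (* A default value: at [d = 0] the choice [r = 1 - 1 / sqrt (d + 1)] would give
     [r = 0]. *)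
  case=> [|d]; first by exists (0, 0, 0).
  by have [r [t [P H]]] := @cyclic_parameters R d.+1 isT; exists (r, t, P).
exists (fun d => let: (r, t, P) := g d in
  convex_hull (cyclic_vertex d r t P)); split.
- move=> d /ltnW d0; have := gP d d0; case: (g d) => [[r t] P].
  move=> [r01 P0 tr tP _]; split; last exact: cyclic_simplex_lattice_free.
  exists (cyclic_vertex d r t P); split=> //.
  by apply: cyclic_vertex_free => //; case/andP: r01.
- exists 6, (fun d => let: (r, t, P) := g d in 2 * d%:R - P * (1 + r)).
  split=> // d /ltnW d0; have := gP d d0; case: (g d) => [[r t] P].
  move=> [/andP[r0 _] P0 _ _ fd]; split=> //.
  rewrite opprB addrC subrK.
  case: d d0 {fd} => // d _; apply: cyclic_simplex_lattice_width => //.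
  exact: ltW.
Qed.
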